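(* Let $I, J \geq 1$ be integers and let $\mathbf b = (b_{ij})_{1\le i\le I,\,1\le j\le J}$ be an array of positive integers (so every cell is bounded and there are no structural zeros). Then for every choice of row sums $(r_1,\dots,r_I) \in \mathbb N^I$ and column sums $(c_1,\dots,c_J)\in\mathbb N^J$, the set of all basic moves of $2\times 2$ minors (which is the standard Markov basis for $I \times J$ tables with fixed row and column sums and no bounds) is a Markov subbasis for the bounded tables with these margins. That is, with $$\mathcal F^{\mathbf b} = \Big\{ \mathbf n \in \mathbb N^{I\times J} \ :\ \sum_{j=1}^J n_{ij} = r_i \ \forall i,\ \ \sum_{i=1}^I n_{ij} = c_j\ \forall j,\ \ n_{ij} \le b_{ij}\ \forall i,j \Big\},$$ for any $\mathbf u, \mathbf v \in \mathcal F^{\mathbf b}$ there exist $l \geq 0$ and basic moves $\mathbf m_1,\dots,\mathbf m_l$ such that $\mathbf u = \mathbf v + \sum_{i=1}^l \mathbf m_i$ and $\mathbf v + \sum_{i=1}^{t} \mathbf m_i \in \mathcal F^{\mathbf b}$ for all $t = 1,\dots,l$.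
   Context: $\mathbb N = \{0,1,2,\dots\}$. For $1 \le i \le I$, $1\le j\le J$ let $E_{ij}$ denote the $I\times J$ integer array with entry $1$ in cell $(i,j)$ and $0$ elsewhere. A basic move is an array $\pm(E_{i_1j_1} + E_{i_2j_2} - E_{i_1j_2} - E_{i_2j_1})$ with $i_1 \ne i_2$ and $j_1 \ne j_2$ (both signs are allowed); it corresponds to a $2 \times 2$ minor of the table. A structural zero is a cell whose upper bound is $0$. *)

(* Defs.v *)
From mathcomp Require Import all_boot all_order all_algebra.

Set Implicit Arguments.
Unset Strict Implicit.
Unset Printing Implicit Defensive.

Import Order.TTheory GRing.Theory Num.Theory.
Local Open Scope ring_scope.

(* delta_mx i j is the array E_ij. *)
Definition basic_move (I J : nat) (m : 'M[int]_(I, J)) : Prop :=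
  exists (i1 i2 : 'I_I) (j1 j2 : 'I_J),
    let q : 'M[int]_(I, J) :=
      delta_mx i1 j1 + delta_mx i2 j2 - delta_mx i1 j2 - delta_mx i2 j1 in
    [/\ i1 != i2, j1 != j2 & m = q \/ m = - q].

(* Tables in N^(I x J) are represented as integer arrays with nonnegative
   entries, so that moves can be added to them without truncation. *)
Definition bounded_fiber (I J : nat) (b : 'M[nat]_(I, J))
    (r : 'I_I -> nat) (c : 'I_J -> nat) (n : 'M[int]_(I, J)) : Prop :=
  [/\ forall i j, 0 <= n i j,
      forall i, \sum_(j < J) n i j = (r i)%:Z,
      forall j, \sum_(i < I) n i j = (c j)%:Z
    & forall i j, n i j <= (b i j)%:Z].

(* The moves are indexed from 0, so the t-th partial sum v + m_1 + ... + m_t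
   of the usual numbering ranges over the indices k < t. *)
Definition markov_subbasis (I J : nat) (F B : 'M[int]_(I, J) -> Prop) : Prop :=
  forall u v : 'M[int]_(I, J), F u -> F v ->
    exists (l : nat) (m : 'I_l -> 'M[int]_(I, J)),
      [/\ forall k, B (m k),
          u = v + \sum_(k < l) m k
        & forall t : nat, (1 <= t <= l)%N ->
            F (v + \sum_(k < l | (k < t)%N) m k)].

(* Main.v *)
Require Import Defs.
From mathcomp Require Import all_boot all_order all_algebra.
From Stdlib Require Import Relations.
From mathcomp Require Import zify.

Set Implicit Arguments.
Unset Strict Implicit.
Unset Printing Implicit Defensive.

Import Order.TTheory GRing.Theory Num.Theory.
Local Open Scope ring_scope.

(** Given distinct [u] and [v] in the fiber, put [d = u - v] and let row [i]
    have the largest number of positive entries of [d].  Row sums of [d] vanish,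
    so [d i j < 0] for some [j], and then [d i' j > 0] for some [i'].  By
    maximality some [j1] has [d i j1 > 0] and [d i' j1 <= 0].  The basic move on
    rows [i, i'] and columns [j, j1] brings [u] closer to [v] in at least three of its
    four cells; at the fourth, [(i', j1)], we have [u <= v], so either [u < b] and
    the move can be added to [u], or [v = b > 0] and it can be subtracted from
    [v].  Either way the l1 distance between the two tables drops. *)

Definition rect_move (I J : nat) (i i' : 'I_I) (j j' : 'I_J) : 'M[int]_(I, J) :=
  delta_mx i j + delta_mx i' j' - delta_mx i j' - delta_mx i' j.

Definition l1norm (I J : nat) (d : 'M[int]_(I, J)) : int :=
  \sum_i \sum_j `|d i j|.

(** Otherwise the nonnegative values [- f y] would sum to zero, hence all vanish, against
    [f x != 0]. *)
Lemma exists_gt0_of_sum0 (T : finType) (f : T -> int) (x : T) :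
  \sum_y f y = 0 -> f x != 0 -> exists y, 0 < f y.
Proof.
move=> f0 fx; apply/existsP; apply: contraT; rewrite negb_exists => /forallP le0.
have: \sum_y - f y == 0 by rewrite sumrN f0 oppr0.
rewrite psumr_eq0 => [/allP/(_ x)|y _]; last by have := le0 y; lia.
by rewrite mem_index_enum oppr_eq0 (negPf fx) => /(_ isT).
Qed.

Lemma exists_lt0_of_sum0 (T : finType) (f : T -> int) (x : T) :
  \sum_y f y = 0 -> f x != 0 -> exists y, f y < 0.
Proof.
move=> f0 fx; case: (@exists_gt0_of_sum0 T (fun y => - f y) x).
- by rewrite sumrN f0 oppr0.
- by rewrite oppr_eq0.
by move=> y; rewrite oppr_gt0; exists y.
Qed.

Lemma sum_delta_row (I J : nat) (i0 : 'I_I) (j0 : 'I_J) (i : 'I_I) :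
  \sum_j (delta_mx i0 j0 : 'M[int]_(I, J)) i j = (i == i0)%:R.
Proof.
rewrite (bigD1 j0) //= mxE eqxx andbT big1 ?addr0 // => j /negPf jj0.
by rewrite mxE jj0 andbF.
Qed.

Lemma sum_delta_col (I J : nat) (i0 : 'I_I) (j0 : 'I_J) (j : 'I_J) :
  \sum_i (delta_mx i0 j0 : 'M[int]_(I, J)) i j = (j == j0)%:R.
Proof.
rewrite (bigD1 i0) //= mxE eqxx andTb big1 ?addr0 // => i /negPf ii0.
by rewrite mxE ii0.
Qed.

Lemma sum_delta (I J : nat) (i0 : 'I_I) (j0 : 'I_J) :
  \sum_i \sum_j (delta_mx i0 j0 : 'M[int]_(I, J)) i j = 1.
Proof.
under eq_bigr do rewrite sum_delta_row.
rewrite (bigD1 i0) //= eqxx big1 ?addr0 // => i /negPf ii0.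
by rewrite ii0.
Qed.

Lemma rect_move_row (I J : nat) (i i' : 'I_I) (j j' : 'I_J) (k : 'I_I) :
  \sum_l rect_move i i' j j' k l = 0.
Proof.
transitivity (\sum_l ((delta_mx i j : 'M[int]_(I, J)) k l + delta_mx i' j' k l
  - delta_mx i j' k l - delta_mx i' j k l)).
  by apply: eq_bigr => l _; rewrite !mxE.
by rewrite !sumrB big_split /= !sum_delta_row; lia.
Qed.

Lemma rect_move_col (I J : nat) (i i' : 'I_I) (j j' : 'I_J) (l : 'I_J) :
  \sum_k rect_move i i' j j' k l = 0.
Proof.
transitivity (\sum_k ((delta_mx i j : 'M[int]_(I, J)) k l + delta_mx i' j' k l
  - delta_mx i j' k l - delta_mx i' j k l)).
  by apply: eq_bigr => k _; rewrite !mxE.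
by rewrite !sumrB big_split /= !sum_delta_col; lia.
Qed.

Lemma basic_rect_move (I J : nat) (i i' : 'I_I) (j j' : 'I_J) :
  i != i' -> j != j' -> basic_move (rect_move i i' j j').
Proof. by move=> ii jj; exists i, i', j, j'; split => //; left. Qed.

Lemma basic_moveN (I J : nat) (m : 'M[int]_(I, J)) :
  basic_move m -> basic_move (- m).
Proof.
move=> [i [i' [j [j' [ii jj [->|->]]]]]]; exists i, i', j, j'; split => //.
  by right.
by left; rewrite opprK.
Qed.

(** Nine cases: row [k] is [i], [i'] or neither, and likewise for column [l]. In each the delta
    entries become constants, which leaves linear goals. *)
Ltac split_cells k l ii jj :=
  match type of ii with is_true (?i != ?i') =>
  match type of jj with is_true (?j != ?j') =>
    (case: (eqVneq k i) => [->|_];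
      [rewrite (negPf ii)|case: (eqVneq k i') => [->|_]]);
    (case: (eqVneq l j) => [->|_];
      [rewrite (negPf jj)|case: (eqVneq l j') => [->|_]]) => /=
  end end.

(** Three corners move one unit towards zero, and the fourth grows by at most one in absolute value,
    whatever its sign: the norm drops by at least 2. *)
Lemma l1norm_rect_move (I J : nat) (d : 'M[int]_(I, J)) (i i' : 'I_I)
    (j j' : 'I_J) :
  i != i' -> j != j' -> d i j < 0 -> 0 < d i' j -> 0 < d i j' ->
  l1norm (d + rect_move i i' j j') < l1norm d.
Proof.
move=> ii jj dij di'j dij'.
have: l1norm (d + rect_move i i' j j') <= \sum_k \sum_l (`|d k l|
    + (delta_mx i' j' : 'M[int]_(I, J)) k l - delta_mx i j k l
    - delta_mx i j' k l - delta_mx i' j k l).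
  apply: ler_sum => k _; apply: ler_sum => l _; rewrite !mxE.
  by split_cells k l ii jj; lia.
under eq_bigr do rewrite !sumrB big_split /=.
rewrite !sumrB big_split /= !sum_delta -/(l1norm d) => /le_lt_trans; apply.
by move: (l1norm d) => s; lia.
Qed.

Lemma bounded_fiberD (I J : nat) (b : 'M[nat]_(I, J)) (r : 'I_I -> nat)
    (c : 'I_J -> nat) (n m : 'M[int]_(I, J)) :
  bounded_fiber b r c n ->
  (forall i, \sum_j m i j = 0) -> (forall j, \sum_i m i j = 0) ->
  (forall i j, 0 <= n i j + m i j <= (b i j)%:Z) ->
  bounded_fiber b r c (n + m).
Proof.
move=> [_ nr nc _] mr mc nm; split=> [i j|i|j|i j].
- by rewrite mxE; case/andP: (nm i j).
- by under eq_bigr do rewrite mxE; rewrite big_split /= nr mr addr0.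
- by under eq_bigr do rewrite mxE; rewrite big_split /= nc mc addr0.
- by rewrite mxE; case/andP: (nm i j).
Qed.

Lemma exists_rect (I J : nat) (d : 'M[int]_(I, J)) :
  (forall i, \sum_j d i j = 0) -> (forall j, \sum_i d i j = 0) -> d != 0 ->
  exists (i i' : 'I_I) (j j' : 'I_J),
    [/\ d i j < 0, 0 < d i' j, 0 < d i j' & d i' j' <= 0].
Proof.
move=> dr dc dn0.
have [i0 [j0 d0]] : exists i j, d i j != 0.
  apply/'exists_existsP; apply: contraNT dn0; rewrite negb_exists => /forallP d0.
  apply/eqP/matrixP => i j; rewrite mxE.
  by have := d0 i; rewrite negb_exists => /forallP/(_ j); rewrite negbK => /eqP.
have [j1 d1] := exists_gt0_of_sum0 (dr i0) d0.
pose Pos i := [set j | 0 < d i j].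
case: (@arg_maxnP _ i0 predT (fun i => #|Pos i|) isT) => i _ maxi.
(* Row [i0] has a positive entry, so the maximal row [i] has one too; being nonzero with zero sum,
   it also has a negative entry. *)
have [j2] : exists j, j \in Pos i.
  apply/set0Pn; rewrite -card_gt0 (leq_trans _ (maxi i0 isT)) //.
  by rewrite card_gt0; apply/set0Pn; exists j1; rewrite inE.
rewrite inE => d2; have [j dj] := exists_lt0_of_sum0 (dr i) (lt0r_neq0 d2).
have [i' di'] := exists_gt0_of_sum0 (dc j) (ltr0_neq0 dj).
(* If [Pos i] were contained in [Pos i'], column [j] would make the inclusion strict, against the
   maximality of row [i]. *)
have [j' Pj' nPj'] : exists2 j', j' \in Pos i & j' \notin Pos i'.
  apply/subsetPn/negP => sub.
  have /proper_card : Pos i \proper Pos i'.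
    by apply/properP; split=> //; exists j; rewrite inE // -leNgt ltW.
  by rewrite ltnNge => /negP; apply; exact: maxi.
by exists i, i', j, j'; split=> //; move: Pj' nPj'; rewrite !inE -?leNgt.
Qed.

(** Only the arrival table must lie in [F]: the start of a path is in [F] by assumption, and partial
    sums are checked from [t = 1] on. *)
Definition fiber_step (I J : nat) (F B : 'M[int]_(I, J) -> Prop)
  (x y : 'M[int]_(I, J)) : Prop := F y /\ B (y - x).

Lemma fiber_connected (I J : nat) (b : 'M[nat]_(I, J)) (r : 'I_I -> nat)
    (c : 'I_J -> nat) (u v : 'M[int]_(I, J)) :
  (forall i j, 0 < b i j)%N -> bounded_fiber b r c u -> bounded_fiber b r c v ->
  clos_refl_trans _ (fiber_step (bounded_fiber b r c) (@basic_move I J)) v u.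
Proof.
(* Induction on a strict bound for the distance, for all pairs [u], [v], since either end may move;
   the bound 0 is impossible. *)
move=> hb; have [n] : exists n : nat, l1norm (u - v) < n%:Z.
  by exists `|l1norm (u - v)|.+1%N; lia.
elim: n u v => [|n IHn] u v dn Fu Fv.
  have : 0 <= l1norm (u - v) by apply: sumr_ge0 => i _; apply: sumr_ge0.
  by lia.
have {}dn : l1norm (u - v) <= n%:Z by lia.
have [->|] := eqVneq u v; first exact: rt_refl.
rewrite -subr_eq0 => uv.
have [u0 ur uc ub] := Fu; have [v0 vr vc vb] := Fv.
have dr i : \sum_j (u - v) i j = 0.
  by under eq_bigr do rewrite 2!mxE; rewrite sumrB ur vr subrr.
have dc j : \sum_i (u - v) i j = 0.
  by under eq_bigr do rewrite 2!mxE; rewrite sumrB uc vc subrr.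
have [i [i' [j [j' [dij di'j dij' di'j']]]]] := exists_rect dr dc uv.
have ii : i != i' by apply/eqP => e; move: di'j; rewrite -e; lia.
have jj : j != j' by apply/eqP => e; move: dij'; rewrite -e; lia.
have := l1norm_rect_move ii jj dij di'j dij'.
have Bm := basic_rect_move ii jj.
have mr := rect_move_row i i' j j'; have mc := rect_move_col i i' j j'.
have mE k l : rect_move i i' j j' k l = ((k == i) && (l == j))%:R
    + ((k == i') && (l == j'))%:R - ((k == i) && (l == j'))%:R
    - ((k == i') && (l == j))%:R by rewrite !mxE.
set m := rect_move i i' j j' in Bm mr mc mE * => dm.
have {}dij : u i j < v i j by move: dij; rewrite 2!mxE subr_lt0.
have {}di'j : v i' j < u i' j by move: di'j; rewrite 2!mxE subr_gt0.
have {}dij' : v i j' < u i j' by move: dij'; rewrite 2!mxE subr_gt0.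
have {}di'j' : u i' j' <= v i' j' by move: di'j'; rewrite 2!mxE subr_le0.
have [uB|uB] := ltP (u i' j') (b i' j')%:Z.
  (* The raised cells have [u < v <= b] or [u < b]; the lowered ones have [u > v >= 0]. *)
  have Fum : bounded_fiber b r c (u + m).
    apply: bounded_fiberD => // k l; rewrite mE.
    move: (u0 k l) (ub k l) (v0 k l) (vb k l).
    by split_cells k l ii jj; lia.
  (* The path reaches [u + m] by induction and ends with the move [- m]. The remaining difference is
     [(u - v) + m], as it is for the pair [u], [v - m] below. *)
  apply: (@rt_trans _ _ _ (u + m)).
    by apply: IHn => //; rewrite addrAC; exact: lt_le_trans dm dn.
  apply: rt_step; split=> //.
  by rewrite opprD addNKr; exact: basic_moveN.
(* Here [v = b] at [(i', j')], and positivity of [b] allows subtracting one there. *)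
have Fvm : bounded_fiber b r c (v - m).
  apply: bounded_fiberD => // [k|l|k l].
  - by under eq_bigr do rewrite mxE; rewrite sumrN mr oppr0.
  - by under eq_bigr do rewrite mxE; rewrite sumrN mc oppr0.
  rewrite mxE mE; move: (u0 k l) (ub k l) (v0 k l) (vb k l) (hb i' j').
  by split_cells k l ii jj; lia.
apply: (@rt_trans _ _ _ (v - m)).
  by apply: rt_step; split=> //; rewrite addrAC subrr add0r; exact: basic_moveN.
by apply: IHn => //; rewrite opprB addrA addrAC; exact: lt_le_trans dm dn.
Qed.

Lemma markov_subbasis_connected (I J : nat) (F B : 'M[int]_(I, J) -> Prop) :
  (forall u v, F u -> F v -> clos_refl_trans _ (fiber_step F B) v u) ->
  markov_subbasis F B.
Proof.
move=> conn u v Fu Fv.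
(* Paths are taken to grow at their final end, so that each new move is appended last. *)
elim: {Fu}u / (clos_rt_rtn1 _ _ _ _ (conn u v Fu Fv)) => [|y z [Fz Bzy] _].
  by exists 0, (fun=> 0); split=> [[]//||[]//]; rewrite big_ord0 addr0.
move=> [l [m [Bm yE Fm]]].
(* [insub] fails only at [k = l], where the default value supplies the new last move. *)
pose m' (k : 'I_l.+1) := oapp m (z - y) (insub (k : nat)).
have m'w (k : 'I_l) : m' (widen_ord (leqnSn l) k) = m k by rewrite /m' valK.
have m'max : m' ord_max = z - y by rewrite /m' insubF //= ltnn.
have zE : z = v + \sum_k m' k.
  rewrite big_ord_recr /= m'max; under eq_bigr do rewrite m'w.
  by rewrite addrA -yE subrKC.
exists l.+1, m'; split=> [k||t /andP[t0]] //.
  by rewrite /m'; case: insub => [k'|] /=.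
(* For [t = l + 1] the partial sum is all of [z]; for smaller [t] the last move is left out and the
   sum is one of the old path. *)
rewrite leq_eqVlt => /predU1P[->|tl].
  by rewrite (eq_bigl xpredT) => [|k]; rewrite -?zE ?ltn_ord.
rewrite big_mkcond big_ord_recr /= ltnNge -ltnS tl addr0 -big_mkcond /=.
under eq_bigr do rewrite m'w.
by apply: Fm; rewrite t0.
Qed.

Theorem theorem3 (I J : nat) (hI : (1 <= I)%N) (hJ : (1 <= J)%N)
    (b : 'M[nat]_(I, J)) (hb : forall i j, (0 < b i j)%N)
    (r : 'I_I -> nat) (c : 'I_J -> nat) :
  markov_subbasis (bounded_fiber b r c) (@basic_move I J).
Proof.
by apply: markov_subbasis_connected => u v Fu Fv; exact: fiber_connected.
Qed.
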